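(* Let $\sigma:\Sigma\to\Sigma$ be a topologically transitive one-sided subshift of finite type, let $u:\Sigma\to(0,+\infty)$ be Hölder continuous, and let $\mathcal{W}$ be a finite set of admissible words. Let $\mathcal{F}_{\mathcal{W}}=\bigcup_{k=1}^\infty\mathcal{F}_{\mathcal{W},k}$ and $\mathcal{F}'_{\mathcal{W}}=\bigcup_{l=1}^\infty\mathcal{F}'_{\mathcal{W},l}$, where $$\mathcal{F}_{\mathcal{W},k}=\bigcap_{n=0}^\infty\{\xi\in\Sigma:\text{all the words in }\mathcal{W}\text{ are subwords of }\xi_{n+1}\cdots\xi_{n+k}\},$$ $$\mathcal{F}'_{\mathcal{W},l}=\bigcap_{\omega\in\mathcal{W}}\{\xi\in\Sigma:\xi\text{ does not contain }\omega^l\text{ as a subword}\},$$ and $\omega^l$ is the $l$-fold concatenation of $\omega$. Then $\dim_u(\mathcal{F}_{\mathcal{W}})=\dim_u(\mathcal{F}'_{\mathcal{W}})=\dim_u(\Sigma)$.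
   Context: Subshift of finite type (SFT): $A$ is a finite set with at least two symbols, and $\mathbb{M}:A\times A\to\{0,1\}$ is a matrix such that for each $a\in A$ there is $b\in A$ with $\mathbb{M}(a,b)=1$. A word or infinite sequence over $A$ is admissible if each of its subwords $ab$ of length two (consecutive letters) satisfies $\mathbb{M}(a,b)=1$ (the empty word and words of length one are vacuously admissible). Subwords are contiguous blocks. $\Sigma\subseteq A^{\mathbb{N}}$ ($\mathbb{N}=\{1,2,\dots\}$) is the set of admissible sequences and $\sigma(\xi_1\xi_2\cdots)=\xi_2\xi_3\cdots$. The SFT is topologically transitive iff for all $a,b\in A$ there is an admissible word $\rho$ (possibly empty) with $a\rho b$ admissible. For an admissible word $\omega$ of length $|\omega|$, $[\omega]=\{\xi\in\Sigma:\xi_1\cdots\xi_{|\omega|}=\omega\}$; $[\text{empty word}]=\Sigma$. For $f:\Sigma\to\mathbb{R}$: $S_nf=\sum_{k=0}^{n-1}f\circ\sigma^k$, $S_0f=0$; for an admissible word $\omega$, $S_\omega f=\sup_{\xi\in[\omega]}S_{|\omega|}f(\xi)$. Metrics: for distinct $\xi,\xi'\in\Sigma$ let $\xi\wedge\xi'$ be their longest common initial block; $d_1(\xi,\xi')=\exp(-|\xi\wedge\xi'|)$. Hölder continuity of functions on $\Sigma$ is with respect to $d_1$ (with some positive exponent). For Hölder continuous $u:\Sigma\to(0,+\infty)$, $d_u(\xi,\xi')=\exp(S_{\xi\wedge\xi'}(-u))$ for $\xi\neq\xi'$, which is a metric on $\Sigma$. The $u$-dimension $\dim_u(E)$ of $E\subseteq\Sigma$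 is the Hausdorff dimension of $E$ in $(\Sigma,d_u)$.
   Formalization: The equality for F'_W is stated only when the empty word is not in W: if the empty word is in W, F'_W is empty and has dimension 0, so the claim fails, e.g. for the full shift; the equality for F_W is stated for every W. *)

(* Defs.v *)
From mathcomp Require Import all_boot all_order all_algebra.
From mathcomp Require Import all_classical all_reals all_analysis.

Set Implicit Arguments.
Unset Strict Implicit.
Unset Printing Implicit Defensive.

Import Order.TTheory GRing.Theory Num.Theory.
Local Open Scope classical_set_scope.
Local Open Scope ring_scope.

(* Hausdorff measure and dimension of E : set T for a distance d : T -> T -> R *)
Section Hausdorff.
Variables (R : realType) (T : Type) (d : T -> T -> R).

(* diam set0 = -oo *)
Definition diam (U : set T) : \bar R :=
  ereal_sup [set (d p.1 p.2)%:E | p in U `*` U].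

(* The empty set weighs 0 for every exponent, including s = 0; a nonempty set
   of diameter 0 weighs 1 for s = 0. *)
Definition diam_pow (s : R) (U : set T) : \bar R :=
  if U == set0 then 0%E else poweR (diam U) s.

Definition hausdorff_premeasure (s delta : R) (E : set T) : \bar R :=
  ereal_inf [set (\sum_(0 <= i <oo) diam_pow s (U i))%E | U in
    [set U : nat -> set T | E `<=` \bigcup_i U i /\
                            forall i, (diam (U i) <= delta%:E)%E]].

(* The premeasures increase as delta decreases: the limit at 0 is a supremum. *)
Definition hausdorff_measure (s : R) (E : set T) : \bar R :=
  ereal_sup [set hausdorff_premeasure s delta E | delta in
    [set delta : R | 0 < delta]].

Definition hausdorff_dim (E : set T) : \bar R :=
  ereal_inf [set s%:E | s in
    [set s : R | 0 <= s /\ hausdorff_measure s E = 0%E]].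

End Hausdorff.

(* Sequences are functions on nat, indexed from 0: xi i is the (i+1)-st letter.
   The 0-1 transition matrix is M : rel A. An admissible finite word is
   w : seq A such that sorted M w. *)
Section Subshift.
Variables (A : finType) (M : rel A).

Definition Sigma : set (nat -> A) := [set xi | forall i, M (xi i) (xi i.+1)].

Lemma shift_subproof (xi : Sigma) : (fun i => val xi i.+1) \in Sigma.
Proof. by apply/mem_set => i; exact: (set_mem (valP xi)). Qed.

Definition shift (xi : Sigma) : Sigma := SigSub (shift_subproof xi).

Definition transitive_sft : Prop :=
  forall a b : A, exists rho : seq A,
    sorted M rho /\ sorted M (a :: rcons rho b).

(* xi_{n+1} ... xi_{n+k} *)
Definition block (xi : Sigma) (n k : nat) : seq A :=
  [seq val xi i | i <- iota n k].

Definition contains (xi : Sigma) (w : seq A) : Prop :=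
  exists n, block xi n (size w) = w.

Definition cylinder (w : seq A) : set Sigma :=
  [set xi | block xi 0 (size w) = w].

(* For xi = xi' there is no longest common initial block; the value is then
   arbitrary and never used. *)
Definition wedge (xi xi' : Sigma) : seq A :=
  block xi 0 (xget 0%N
    [set n | block xi 0 n = block xi' 0 n /\
             forall m, block xi 0 m = block xi' 0 m -> (m <= n)%N]).

Variable R : realType.

Definition birkhoff_sum (f : Sigma -> R) (n : nat) (xi : Sigma) : R :=
  \sum_(k < n) f (iter k shift xi).

(* A real supremum; it is only meaningful for sums bounded above on a nonempty
   cylinder, as in d_u, where w is an initial block and f = - u < 0. *)
Definition birkhoff_word (f : Sigma -> R) (w : seq A) : R :=
  sup [set birkhoff_sum f (size w) xi | xi in cylinder w].

Definition d_1 (xi xi' : Sigma) : R :=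
  if `[< xi = xi' >] then 0 else expR (- (size (wedge xi xi'))%:R).

Definition hoelder_continuous (f : Sigma -> R) : Prop :=
  exists alpha C : R, 0 < alpha /\
    forall xi xi', `|f xi - f xi'| <= C * (d_1 xi xi') `^ alpha.

Definition d_u (u : Sigma -> R) (xi xi' : Sigma) : R :=
  if `[< xi = xi' >] then 0
  else expR (birkhoff_word (fun x => - u x) (wedge xi xi')).

Definition dim_u (u : Sigma -> R) (E : set Sigma) : \bar R :=
  hausdorff_dim (d_u u) E.

End Subshift.

Section WordSets.
Variables (A : finType) (M : rel A) (W : set (seq A)).

Definition F_k (k : nat) : set (Sigma M) :=
  \bigcap_n [set xi | forall w, W w -> infix w (block xi n k)].

Definition F : set (Sigma M) := \bigcup_(k in [set k | (1 <= k)%N]) F_k k.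

Definition wpow (w : seq A) (l : nat) : seq A := flatten (nseq l w).

Definition F'_l (l : nat) : set (Sigma M) :=
  \bigcap_(w in W) [set xi | ~ contains xi (wpow w l)].

Definition F' : set (Sigma M) := \bigcup_(l in [set l | (1 <= l)%N]) F'_l l.

End WordSets.

(* Main.v *)
(** For F_W, fix at every letter [a] a loop containing all words of [W], all
    loops having the same length L, and send a point of Sigma to the sequence
    obtained by inserting such a loop after every N letters. The image lies in
    F_W. By bounded distortion each insertion costs a bounded amount in the
    Birkhoff sums of [u], whereas N letters contribute at least N inf u; hence
    d_u(x, y)^(1 + e) <= C d_u(h x, h y) for the insertion map h as soon as N is
    large. Pulling back covers along h gives dim Sigma <= (1 + e) dim F_W for
    every e > 0.

    For F'_W, either some [w] in [W] has all admissible words as subwords of its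
    powers, and then Sigma is finite, of dimension 0; or every [w] in [W] has an
    admissible word that is a subword of no power of [w], and the set W' of these
    words satisfies F_W' <= F'_W. *)

Require Import Defs.
From mathcomp Require Import all_boot all_order all_algebra.
From mathcomp Require Import all_classical all_reals all_analysis.
From mathcomp Require Import zify ring lra.

Set Implicit Arguments.
Unset Strict Implicit.
Unset Printing Implicit Defensive.

Import Order.TTheory GRing.Theory Num.Theory.
Import numFieldNormedType.Exports.
Local Open Scope classical_set_scope.
Local Open Scope ring_scope.

(** * Hausdorff dimension and expanding maps *)

Section HausdorffDimension.
Variable R : realType.
Implicit Types (r s : R).

Lemma diam_pow_ge0 T (d : T -> T -> R) s (U : set T) : (0 <= diam_pow d s U)%E.
Proof. by rewrite /diam_pow; case: ifP => // _; exact: poweR_ge0. Qed.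

Lemma diam_ge T (d : T -> T -> R) (U : set T) x y :
  U x -> U y -> ((d x y)%:E <= diam d U)%E.
Proof. by move=> Ux Uy; apply: ereal_sup_ubound; exists (x, y). Qed.

Lemma diam_le T (d : T -> T -> R) (U : set T) (D : \bar R) :
  (forall x y, U x -> U y -> ((d x y)%:E <= D)%E) -> (diam d U <= D)%E.
Proof. by move=> UD; apply: ge_ereal_sup => _ [[x y] [Ux Uy] <-]; exact: UD. Qed.

Lemma hausdorff_premeasure_ge0 T (d : T -> T -> R) s r (E : set T) :
  (0 <= hausdorff_premeasure d s r E)%E.
Proof.
apply: le_ereal_inf_tmp => _ [U _ <-].
by apply: nneseries_ge0 => i _ _; exact: diam_pow_ge0.
Qed.

Lemma hausdorff_measure_eq0 T (d : T -> T -> R) s (E : set T) :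
  (forall r, 0 < r -> (hausdorff_premeasure d s r E <= 0)%E) <->
  hausdorff_measure d s E = 0%E.
Proof.
split=> [h0|h0 r r0].
  apply/eqP; rewrite eq_le; apply/andP; split.
    by apply: ge_ereal_sup => _ [r r0 <-]; exact: h0.
  apply: le_trans (hausdorff_premeasure_ge0 d s 1 E) _.
  by apply: ereal_sup_ubound; exists 1 => //=.
by rewrite -h0; apply: ereal_sup_ubound; exists r.
Qed.

(** * Pulling covers back along a map that does not contract too much *)

Section Transfer.
Context {T1 T2 : Type} (d1 : T1 -> T1 -> R) (d2 : T2 -> T2 -> R).
Variables (h : T1 -> T2) (a C : R).
Hypotheses (a_gt0 : 0 < a) (C_gt0 : 0 < C).
Hypotheses (d1_ge0 : forall x y, 0 <= d1 x y) (d2_ge0 : forall x y, 0 <= d2 x y).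
Hypothesis d1_le : forall x y, d1 x y `^ a <= C * d2 (h x) (h y).

Lemma diam_preimage (U : set T2) (D : R) : 0 <= D -> (diam d2 U <= D%:E)%E ->
  (diam d1 (h @^-1` U) <= ((C * D) `^ a^-1)%:E)%E.
Proof.
move=> D0 UD; apply: diam_le => x y Ux Uy; rewrite lee_fin.
have xyD : d2 (h x) (h y) <= D.
  by rewrite -lee_fin; apply: le_trans UD; exact: diam_ge.
rewrite -[leLHS]powRr1 // -(divff (lt0r_neq0 a_gt0)) powRrM.
apply: ge0_ler_powR; rewrite ?nnegrE ?invr_ge0 ?powR_ge0 ?(ltW a_gt0) //.
  by rewrite mulr_ge0 // ltW.
by apply: le_trans (d1_le x y) _; rewrite ler_pM2l.
Qed.

(** The exponent [a * s] cancels the root [a^-1] of [diam_preimage]. A nonempty preimage forces [U]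
    to be nonempty, so the convention of [diam_pow] for the empty set is respected even for
    [s = 0]. *)
Lemma diam_pow_preimage (U : set T2) s r : 0 <= s -> (diam d2 U <= r%:E)%E ->
  (diam_pow d1 (a * s) (h @^-1` U) <= (C `^ s)%:E * diam_pow d2 s U)%E.
Proof.
move=> s0 Ur; rewrite {1}/diam_pow; case: ifPn => [_|/set0P[x Ux]].
  by rewrite mule_ge0 ?lee_fin ?powR_ge0 ?diam_pow_ge0.
rewrite /diam_pow ifN; last by apply/set0P; exists (h x).
have dU0 : (0 <= diam d2 U)%E.
  by apply: le_trans (diam_ge d2 Ux Ux); rewrite lee_fin.
have dV0 : (0 <= diam d1 (h @^-1` U))%E.
  by apply: le_trans (diam_ge d1 Ux Ux); rewrite lee_fin.
case E : (diam d2 U) Ur dU0 => [D| |] // Ur D0; rewrite lee_fin in D0.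
have dV : (diam d1 (h @^-1` U) <= ((C * D) `^ a^-1)%:E)%E.
  by apply: diam_preimage; rewrite ?E.
have as0 : 0 <= a * s by rewrite mulr_ge0 // ltW.
apply: (@le_trans _ _ ((((C * D) `^ a^-1)%:E) `^ (a * s))%E).
  by apply: gt0_ler_poweR; rewrite ?in_itv /= ?dV0 ?leey ?andbT ?lee_fin ?powR_ge0.
rewrite !poweR_EFin -powRrM mulrA mulVf ?lt0r_neq0 // mul1r.
by rewrite powRM ?(ltW C_gt0) // EFinM.
Qed.

Lemma hausdorff_measure_preimage_eq0 s (E1 : set T1) (E2 : set T2) : 0 <= s ->
  h @` E1 `<=` E2 ->
  hausdorff_measure d2 s E2 = 0%E -> hausdorff_measure d1 (a * s) E1 = 0%E.
Proof.
move=> s0 hE /hausdorff_measure_eq0 E20; apply/hausdorff_measure_eq0 => r r0.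
pose r' := r `^ a / C.
have r'0 : 0 < r' by rewrite divr_gt0 // powR_gt0.
have Cs0 : 0 < C `^ s by rewrite powR_gt0.
suff : (((C `^ s)^-1)%:E * hausdorff_premeasure d1 (a * s) r E1 <= 0)%E.
  by rewrite lee_pdivrMl // mule0.
apply: le_trans (E20 _ r'0); apply: le_ereal_inf_tmp => _ [U [EU Ur] <-].
rewrite lee_pdivrMl // -nneseriesZl; last by move=> i _; exact: diam_pow_ge0.
apply: (@le_trans _ _ (\sum_(0 <= i <oo) diam_pow d1 (a * s) (h @^-1` U i))%E).
  apply: ereal_inf_lbound; exists (fun i => h @^-1` U i) => //; split.
    move=> x E1x; have [|i _ Ui] := EU (h x); first by apply: hE; exists x.
    by exists i.
  move=> i; apply: le_trans (diam_preimage (ltW r'0) (Ur i)) _.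
  rewrite /r' mulrC divfK ?lt0r_neq0 // -powRrM divff ?lt0r_neq0 //.
  by rewrite powRr1 ?lexx ?(ltW r0).
apply: lee_nneseries => [i _ _|i _]; first exact: diam_pow_ge0.
exact: diam_pow_preimage s0 (Ur i).
Qed.

End Transfer.

Lemma hausdorff_dim_le T1 T2 (d1 : T1 -> T1 -> R) (d2 : T2 -> T2 -> R) E1 E2 :
  (forall x y, 0 <= d1 x y) -> (forall x y, 0 <= d2 x y) ->
  (forall e, 0 < e -> exists (h : T1 -> T2) (C : R), [/\ 0 < C,
     h @` E1 `<=` E2 & forall x y, d1 x y `^ (1 + e) <= C * d2 (h x) (h y)]) ->
  (hausdorff_dim d1 E1 <= hausdorff_dim d2 E2)%E.
Proof.
move=> d10 d20 hyp; apply: le_ereal_inf_tmp => _ [s [s0 Hs] <-].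
apply/lee_addgt0Pr => e e0.
have s1 : 0 < s + 1 by rewrite ltr_wpDl.
(* With this choice [(1 + e / (s + 1)) * s <= s + e]; the denominator is [s + 1] because [s] may be
   0. *)
have [h [C [C0 hE hC]]] := hyp (e / (s + 1)) (divr_gt0 e0 s1).
have a0 : 0 < 1 + e / (s + 1) by rewrite addr_gt0 ?divr_gt0.
have := hausdorff_measure_preimage_eq0 a0 C0 d10 d20 hC s0 hE Hs.
move=> H1; apply: (@le_trans _ _ ((1 + e / (s + 1)) * s)%:E).
  by apply: ereal_inf_lbound; exists ((1 + e / (s + 1)) * s) => //; split=> //;
    rewrite mulr_ge0 // ltW.
rewrite -EFinD lee_fin mulrDl mul1r lerD2l mulrAC ler_pdivrMr //.
by rewrite ler_pM2l // lerDl.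
Qed.

Lemma hausdorff_dim_ge0 T (d : T -> T -> R) E : (0 <= hausdorff_dim d E)%E.
Proof. by apply: le_ereal_inf_tmp => _ [s [s0 _] <-]; rewrite lee_fin. Qed.

Lemma hausdorff_dim_subset T (d : T -> T -> R) E1 E2 : E1 `<=` E2 ->
  (hausdorff_dim d E1 <= hausdorff_dim d E2)%E.
Proof.
move=> E12; apply: le_ereal_inf_tmp => _ [s [s0 /hausdorff_measure_eq0 Hs] <-].
apply: ereal_inf_lbound; exists s => //; split=> //.
apply/hausdorff_measure_eq0 => r r0; apply: le_trans (Hs r r0).
apply: le_ereal_inf => _ [U [EU Ur] <-]; exists U => //; split=> //.
exact: subset_trans EU.
Qed.

(** Sets with at most one point weigh 0 for every exponent [e > 0], at every scale. For exponent 0 a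
    point weighs 1, so the value 0 is reached only as an infimum over [e]. *)
Lemma hausdorff_dim_countable T (d : T -> T -> R) (E : set T) (U : nat -> set T) :
  (forall x, d x x = 0) -> (forall i, is_subset1 (U i)) ->
  E `<=` \bigcup_i U i -> hausdorff_dim d E = 0%E.
Proof.
move=> dxx U1 EU; apply/eqP; rewrite eq_le hausdorff_dim_ge0 andbT.
apply/lee_addgt0Pr => e e0; rewrite add0e.
have dU i : (diam d (U i) <= 0)%E.
  by apply: diam_le => x y Ux Uy; rewrite (U1 i x y Ux Uy) dxx.
apply: ereal_inf_lbound; exists e => //; split; first exact: ltW.
apply/hausdorff_measure_eq0 => r r0.
apply: ereal_inf_lbound; exists U => /=.
  by split=> // i; apply: le_trans (dU i) _; rewrite lee_fin ltW.
apply: eseries0 => i _ _; rewrite /diam_pow; case: ifPn => // /set0P[x Ux].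
have -> : diam d (U i) = 0%E.
  by apply/eqP; rewrite eq_le dU /=; have := diam_ge d Ux Ux; rewrite dxx.
by rewrite poweR0r ?lt0r_neq0.
Qed.

End HausdorffDimension.

(** * Words and loops *)

Section Subshift.
Variables (A : finType) (M : rel A).
Local Open Scope nat_scope.
Implicit Types (x y z : Sigma M) (f : A) (n k : nat) (w : seq A).

Lemma Sigma_ext x y : (forall i, val x i = val y i) -> x = y.
Proof. by move=> xy; apply: val_inj; apply: funext. Qed.

Lemma SigmaP x i : M (val x i) (val x i.+1).
Proof. by have := set_mem (valP x). Qed.

Lemma val_iter_shift x n i : val (iter n (@Defs.shift A M) x) i = val x (n + i).
Proof. by elim: n i => // n IH i; rewrite /= IH addnS. Qed.

Lemma size_block x n k : size (block x n k) = k.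
Proof. by rewrite size_map size_iota. Qed.

Lemma nth_block a x n k i : (i < k) -> nth a (block x n k) i = val x (n + i).
Proof. by move=> ik; rewrite (nth_map 0%N) ?size_iota // nth_iota. Qed.

Lemma block_eqP x y n :
  block x 0 n = block y 0 n <-> forall i, (i < n) -> val x i = val y i.
Proof.
split=> [/eq_in_map xy i iltn|xy]; first by apply: xy; rewrite mem_iota.
by apply/eq_in_map => i; rewrite mem_iota => /xy.
Qed.

Lemma cylinder_blockP x y n :
  cylinder (block x 0 n) y <-> forall i, (i < n) -> val x i = val y i.
Proof.
rewrite /cylinder /= size_block; split=> [/block_eqP yx i /yx //|xy].
by apply/block_eqP => i /xy.
Qed.

Lemma first_difference x y : x <> y ->
  exists n, (forall i, (i < n) -> val x i = val y i) /\ val x n <> val y n.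
Proof.
move=> xy; have ex : exists n, val x n != val y n.
  apply/not_existsP => eqxy; apply: xy; apply: Sigma_ext => i.
  by apply/eqP/negPn/negP; exact: eqxy.
case: (ex_minnP ex) => n /eqP nxy nmin; exists n; split=> // i iltn.
by apply/eqP; apply: contraTT iltn => /nmin; rewrite -leqNgt.
Qed.

(** The set in the definition of [wedge] has exactly one element, the index of the first difference,
    so [xget] never falls back on its default. *)
Lemma wedge_first_difference x y n :
  (forall i, (i < n) -> val x i = val y i) -> val x n <> val y n ->
  wedge x y = block x 0 n.
Proof.
move=> xy nxy; congr block; apply: xget_subset1 => [|i j [ei mi] [ej mj]].
  split=> [|m /block_eqP exy]; first by apply/block_eqP.
  by rewrite leqNgt; apply/negP => /exy.
by apply/eqP; rewrite eqn_leq mi // mj.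
Qed.

Lemma infix_block x n k m j :
  (n <= m) -> (m + j <= n + k) -> infix (block x m j) (block x n k).
Proof.
move=> nm mjnk.
have -> : k = ((m - n) + (j + (n + k - (m + j)))).
  by move: nm mjnk; clear; lia.
rewrite /block !iotaD !map_cat subnKC //; exact: infix_infix.
Qed.

Lemma sorted_block x n k : sorted M (block x n k).
Proof.
case: k => // k; rewrite /block /= path_map.
elim: k n => //= k IH n; rewrite IH andbT; exact: SigmaP.
Qed.

Lemma nth_wpow a w l i : (i < l * size w) ->
  nth a (wpow w l) i = nth a w (i %% size w).
Proof.
elim: l i => // l IH i; rewrite mulSn => il; rewrite /wpow /= nth_cat.
case: ltnP => [iw|wi]; first by rewrite modn_small.
rewrite -/(wpow w l) IH; last by rewrite ltn_subLR.
by rewrite -{2}(subnK wi) modnDr.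
Qed.

Lemma size_wpow w l : size (wpow w l) = (l * size w).
Proof. by rewrite /wpow size_flatten /shape map_nseq sumn_nseq mulnC. Qed.

(** A word that may be inserted after any occurrence of [a]: it can follow [a], and since it ends
    with [a], whatever followed [a] can follow it. *)
Definition loop_at (a : A) (s : seq A) :=
  [/\ path M a s, last a s = a & (0 < size s)].

Lemma loop_at_cat a s t : loop_at a s -> loop_at a t -> loop_at a (s ++ t).
Proof.
move=> [ps ls s0] [pt lt t0]; split; first by rewrite cat_path ps ls.
  by rewrite last_cat ls.
by rewrite size_cat ltn_addr.
Qed.

Lemma loop_at_wpow a s l : loop_at a s -> (0 < l) -> loop_at a (wpow s l).
Proof.
move=> la; case: l => // l _; elim: l => [|l IH]; last exact: loop_at_cat.
by rewrite /wpow /= cats0.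
Qed.

Hypothesis M_trans : transitive_sft M.

Lemma transitive_path a b : exists s, path M a (rcons s b).
Proof. by have [s [_ ?]] := M_trans a b; exists s. Qed.

(** Transitivity leads from [a] to the first letter of [w], and from the last letter of [w] back to
    [a]. *)
Lemma loop_through a w : sorted M w -> exists2 s, loop_at a s & infix w s.
Proof.
case: w => [_|b w pw].
  have [s ps] := transitive_path a a; exists (rcons s a); last exact: infix0s.
  by split; rewrite ?last_rcons // size_rcons.
have [s ps] := transitive_path a b; have [t pt] := transitive_path (last b w) a.
exists (rcons s b ++ w ++ rcons t a); last first.
  by rewrite cat_rcons -[b :: (w ++ _)]/((b :: w) ++ _); exact: infix_infix.
split; rewrite ?cat_path ?last_cat ?last_rcons ?ps ?pt ?andbT //.
by rewrite !size_cat !size_rcons addSn.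
Qed.

Lemma loop_through_all a (ws : seq (seq A)) : all (sorted M) ws ->
  exists2 s, loop_at a s & all (fun w => infix w s) ws.
Proof.
elim: ws => [_|w ws IH /= /andP[sw /IH[s ls sws]]].
  by have [//|s ls _] := loop_through a (w := [::]); exists s.
have [t lt wt] := loop_through a sw; exists (t ++ s).
  exact: loop_at_cat.
rewrite infix_catr //=; apply: sub_all sws => v; exact: infix_catl.
Qed.

(* The common length is the product of the lengths of arbitrary loops, each of
   which is repeated accordingly. *)
Lemma loops_of_same_length (ws : seq (seq A)) : all (sorted M) ws ->
  exists (L : nat) (loop : A -> seq A), (0 < L) /\
    forall a, [/\ loop_at a (loop a), size (loop a) = L &
                  all (fun w => infix w (loop a)) ws].
Proof.
move=> sws; have /choice[s sP] : forall a, exists s, loop_at a s /\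
    all (fun w => infix w s) ws.
  by move=> a; have [s] := loop_through_all a sws; exists s.
have s0 a : (0 < size (s a)) by have [[]] := sP a.
pose L := (\prod_a size (s a)).
have L0 : (0 < L) by apply: prodn_gt0.
have sL a : (size (s a) %| L) by rewrite /L (bigD1 a) //= dvdn_mulr.
exists L, (fun a => wpow (s a) (L %/ size (s a))); split=> // a.
have k0 : (0 < L %/ size (s a)) by rewrite divn_gt0 // dvdn_leq.
have [la wsa] := sP a; split; first exact: loop_at_wpow.
  by rewrite size_wpow divnK.
case: (_ %/ _) k0 => // k _; rewrite /wpow /=.
by apply: sub_all wsa => w; exact: infix_catr.
Qed.

End Subshift.

(** * Insertion of loops *)

Section Insertion.
Variables (A : finType) (M : rel A) (N L : nat) (loop : A -> seq A).
Local Open Scope nat_scope.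
Hypotheses (N_gt0 : 0 < N) (L_gt0 : 0 < L).
Hypothesis loopP : forall a, loop_at M a (loop a).
Hypothesis size_loop : forall a, size (loop a) = L.
Implicit Types (x y : Sigma M) (q r n i : nat).

(* After each block of N letters, ending with a, the word [loop a] is inserted. *)
Definition insertion_fun (xi : nat -> A) (i : nat) : A :=
  let q := i %/ (N + L) in let r := i %% (N + L) in
  if r < N then xi (q * N + r)
  else let a := xi (q * N + N.-1) in nth a (loop a) (r - N).

Lemma insertion_funE xi q r : r < N + L ->
  insertion_fun xi (q * (N + L) + r) =
  if r < N then xi (q * N + r)
  else let a := xi (q * N + N.-1) in nth a (loop a) (r - N).
Proof.
move=> rP; have P0 : 0 < N + L by rewrite addn_gt0 N_gt0.
by rewrite /insertion_fun divnMDl // modnMDl divn_small // modn_small // addn0.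
Qed.

Lemma insertion_subproof x : insertion_fun (val x) \in Sigma M.
Proof.
apply/mem_set => i; have P0 : 0 < N + L by rewrite addn_gt0 N_gt0.
rewrite (divn_eq i (N + L)); set q := _ %/ _; set r := _ %% _.
have rP : r < N + L by rewrite ltn_mod.
pose a := val x (q * N + N.-1); have [/pathP pa la _] := loopP a.
rewrite -addnS insertion_funE //.
have [r1P|Pr1] := ltnP r.+1 (N + L).
  (* Three transitions stay within a period: between two letters of [x], from [a] to the first
     letter of its loop, and inside the loop. *)
  rewrite insertion_funE //; have [rN|Nr] := ltnP r N.
    have [r1N|Nr1] := ltnP r.+1 N; first by rewrite addnS; exact: SigmaP.
    have Nr1E : N = r.+1 by apply/eqP; rewrite eqn_leq Nr1.
    have := pa a 0; rewrite /= size_loop => /(_ L_gt0).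
    by rewrite /a Nr1E /= subnn.
  rewrite ltnNge leqW //= subSn //; have := pa a (r - N).+1; rewrite size_loop /=.
  by apply; rewrite -subSn // ltn_subLR ?leqW // ltnS.
(* At the end of a period the loop has returned to [a], and the next letter is the one that follows
   [a] in [x]. *)
have r1E : r.+1 = N + L by apply/eqP; rewrite eqn_leq rP.
have -> : q * (N + L) + r.+1 = (q + 1) * (N + L) + 0 by rewrite r1E; lia.
rewrite insertion_funE // N_gt0 /= addn0 ltnNge.
have -> /= : N <= r by rewrite -ltnS r1E -addn1 leq_add2l.
have -> : r - N = (size (loop a)).-1 by rewrite size_loop; lia.
rewrite -/a nth_last la /a.
have -> : (q + 1) * N = (q * N + N.-1).+1 by lia.
exact: SigmaP.
Qed.

Definition insertion x : Sigma M := SigSub (insertion_subproof x).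

Lemma insertionE x q r : r < N + L ->
  val (insertion x) (q * (N + L) + r) =
  if r < N then val x (q * N + r)
  else let a := val x (q * N + N.-1) in nth a (loop a) (r - N).
Proof. exact: insertion_funE. Qed.

(** This conjugacy allows induction on the number of blocks in the estimate of Birkhoff sums. *)
Lemma iter_shift_insertion x :
  iter (N + L) (@Defs.shift A M) (insertion x) =
  insertion (iter N (@Defs.shift A M) x).
Proof.
apply: Sigma_ext => i; rewrite val_iter_shift (divn_eq i (N + L)).
have P0 : 0 < N + L by rewrite addn_gt0 N_gt0.
rewrite addnA -[X in X + _ * _]mul1n -mulnDl !insertionE ?ltn_mod //.
by rewrite !val_iter_shift !mulnDl !mul1n !addnA.
Qed.

(** The position to which the insertion moves letter [n]: one loop precedes it for each of the
    [n %/ N] completed blocks. *)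
Definition stretch n := n %/ N * (N + L) + n %% N.

Lemma insertion_stretch x n : val (insertion x) (stretch n) = val x n.
Proof.
have rN : n %% N < N by rewrite ltn_mod.
by rewrite insertionE ?rN -?divn_eq // ltn_addr.
Qed.

(** Every loop inserted before position [stretch n] is determined by a letter before [n]. With
    [insertion_stretch], a first difference at [n] becomes a first difference at [stretch n]. *)
Lemma insertion_agree x y n : (forall i, i < n -> val x i = val y i) ->
  forall i, i < stretch n -> val (insertion x) i = val (insertion y) i.
Proof.
move=> xy i; have P0 : 0 < N + L by rewrite addn_gt0 N_gt0.
rewrite (divn_eq i (N + L)); set q := _ %/ _; set r := _ %% _ => ltin.
have rP : r < N + L by rewrite ltn_mod.
have nE := divn_eq n N; have rN : n %% N < N by rewrite ltn_mod.
have [qn|qn] := ltnP q (n %/ N).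
  have qN : q * N + N <= n.
    by rewrite -mulSnr nE (leq_trans _ (leq_addr _ _)) // leq_mul2r qn orbT.
  rewrite !insertionE //; case: ltnP => rN'.
    by apply: xy; apply: leq_trans qN; rewrite ltn_add2l.
  by rewrite /= xy //; apply: leq_trans qN; rewrite ltn_add2l prednK.
(* The last, incomplete period contains only letters of the original sequences, no part of a
   loop. *)
have qE : q = n %/ N.
  apply/eqP; rewrite eqn_leq qn andbT -ltnS -(@ltn_pmul2r (N + L)) //.
  apply: leq_ltn_trans (leq_addr r _) _; apply: leq_trans ltin _.
  by rewrite /stretch mulSnr leq_add2l ltnW // ltn_addr.
move: ltin; rewrite /stretch -qE ltn_add2l => rn.
rewrite !insertionE // (ltn_trans rn rN); apply: xy.
by rewrite nE -qE ltn_add2l.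
Qed.

Lemma block_insertion_loop x q :
  let a := val x (q * N + N.-1) in
  block (insertion x) (q * (N + L) + N) L = loop a.
Proof.
move=> a; apply: (@eq_from_nth _ a); first by rewrite size_block size_loop.
move=> i; rewrite size_block => iL; rewrite nth_block // -addnA.
rewrite insertionE ?ltn_add2l // ltnNge leq_addr /= addKn.
by [].
Qed.

Lemma insertion_F_k x (W : set (seq A)) :
  (forall a w, W w -> infix w (loop a)) ->
  F_k W (2 * (N + L)) (insertion x).
Proof.
move=> Wl n _ w Ww; have P0 : 0 < N + L by rewrite addn_gt0 N_gt0.
have nE := divn_eq n (N + L); have rP : n %% (N + L) < N + L by rewrite ltn_mod.
(* The first period starting after [n]; it ends before [n + 2 * (N + L)], so its whole loop lies in
   the window. *)
pose q := (n %/ (N + L)).+1.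
apply: infix_trans (Wl (val x (q * N + N.-1)) w Ww) _.
rewrite -block_insertion_loop; apply: infix_block; rewrite /q mulSnr.
  by lia.
by lia.
Qed.

End Insertion.

(** * Birkhoff sums of Hölder potentials *)

Section Potential.
Variables (A : finType) (M : rel A) (R : realType) (u : Sigma M -> R).
Implicit Types (x y : Sigma M) (q r n i : nat).

Lemma d_1_agree x y n : (forall i, (i < n)%N -> val x i = val y i) ->
  d_1 R x y <= expR (- n%:R).
Proof.
rewrite /d_1; case: asboolP => [_ _|xy exy]; first exact: expR_ge0.
have [m [em nm]] := first_difference xy.
rewrite (wedge_first_difference em nm) size_block ler_expR lerN2 ler_nat.
by rewrite leqNgt; apply/negP => /exy.
Qed.

Lemma hoelder_agree : hoelder_continuous u ->
  exists theta C : R, [/\ 0 < theta < 1, 0 < C & forall n x y,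
    (forall i, (i < n)%N -> val x i = val y i) -> `|u x - u y| <= C * theta ^+ n].
Proof.
move=> [alpha [C [alpha0 uC]]]; exists (expR (- alpha)), (`|C| + 1).
split; first by rewrite expR_gt0 -[ltRHS]expR0 ltr_expR oppr_lt0.
  by rewrite ltr_wpDl.
move=> n x y exy; apply: le_trans (uC x y) _.
have dn : d_1 R x y `^ alpha <= expR (- alpha) ^+ n.
  have -> : expR (- alpha) ^+ n = expR (- n%:R) `^ alpha.
    by rewrite /powR expR_eq0 expRK -expRM_natl !mulrN mulrC.
  apply: ge0_ler_powR; rewrite ?nnegrE ?expR_ge0 ?(ltW alpha0) //.
    by rewrite /d_1; case: asboolP => // _; exact: expR_ge0.
  exact: d_1_agree.
apply: le_trans (ler_wpM2l _ dn); last by rewrite addr_ge0.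
by rewrite ler_wpM2r ?powR_ge0 // (le_trans (ler_norm C)) // lerDl.
Qed.

Lemma birkhoff_sumD (f : Sigma M -> R) n r x :
  birkhoff_sum f (n + r) x =
  birkhoff_sum f n x + birkhoff_sum f r (iter n (@Defs.shift A M) x).
Proof.
rewrite /birkhoff_sum big_split_ord /=; congr (_ + _).
by apply: eq_bigr => k _; rewrite addnC iterD.
Qed.

Lemma birkhoff_sumN (f : Sigma M -> R) n x :
  birkhoff_sum (fun y => - f y) n x = - birkhoff_sum f n x.
Proof. by rewrite /birkhoff_sum sumrN. Qed.

Lemma birkhoff_sum_le (f : Sigma M -> R) D n x : (forall y, f y <= D) ->
  birkhoff_sum f n x <= n%:R * D.
Proof.
move=> fD; apply: le_trans (ler_sum _ (fun k _ => fD _)) _.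
by rewrite sumr_const card_ord mulr_natl.
Qed.

Lemma birkhoff_sum_ge (f : Sigma M -> R) c n x : (forall y, c <= f y) ->
  n%:R * c <= birkhoff_sum f n x.
Proof.
move=> fc; apply: le_trans (ler_sum _ (fun k _ => fc _)).
by rewrite sumr_const card_ord mulr_natl.
Qed.

(** * Bounded distortion, and upper and lower bounds of the potential *)

Section Modulus.
Variables (theta C : R).
Hypotheses (theta_itv : 0 < theta < 1) (C_gt0 : 0 < C).
Hypothesis u_agree : forall n x y,
  (forall i, (i < n)%N -> val x i = val y i) -> `|u x - u y| <= C * theta ^+ n.

Let theta_gt0 : 0 < theta. Proof. by case/andP: theta_itv. Qed.
Let theta1_gt0 : 0 < 1 - theta.
Proof. by case/andP: theta_itv => _; rewrite subr_gt0. Qed.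

Lemma birkhoff_distortion n r x y : (r <= n)%N ->
  (forall i, (i < n)%N -> val x i = val y i) ->
  birkhoff_sum u r x <= birkhoff_sum u r y + C / (1 - theta).
Proof.
move=> rn xy; pose K := C / (1 - theta).
have K0 : 0 < K by exact: divr_gt0.
(* The sharper bound carries the induction on [r]: [K] is the sum of the geometric series with
   [K * theta + C = K], which absorbs each new term. *)
suff : birkhoff_sum u r x <= birkhoff_sum u r y + K * theta ^+ (n - r).
  move/le_trans; apply; rewrite lerD2l -[leRHS]mulr1 ler_pM2l //.
  by case/andP: theta_itv => t0 t1; apply: exprn_ile1; exact: ltW.
elim: r rn => [_|r IH rn].
  rewrite /birkhoff_sum !big_ord0 add0r; apply: mulr_ge0; [exact: ltW|].
  by apply: exprn_ge0; exact: ltW.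
have := IH (ltnW rn); rewrite /birkhoff_sum !big_ord_recr /=.
have : `|u (iter r (@Defs.shift A M) x) - u (iter r (@Defs.shift A M) y)|
    <= C * theta ^+ (n - r).
  apply: u_agree => i; rewrite ltn_subRL => /xy.
  by rewrite !val_iter_shift.
move=> /(le_trans (ler_norm _)).
rewrite -[(n - r)%N]prednK ?subn_gt0 // -subnS exprS.
set s := theta ^+ _; have s0 : 0 < s by exact: exprn_gt0.
have KC : K * theta + C = K by rewrite /K; field; rewrite lt0r_neq0.
have Cs : C * (theta * s) <= C * s.
  by rewrite ler_pM2l // ler_piMl ?(ltW s0) //; case/andP: theta_itv => _ /ltW.
have -> : K * s = K * (theta * s) + C * s by rewrite -{1}KC; ring.
lra.
Qed.

Hypothesis u_gt0 : forall x, 0 < u x.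

Lemma u_bounded : exists2 D, 0 < D & forall x, u x <= D.
Proof.
have [[x0 _]|noS] := pselect (exists x0 : Sigma M, True); last first.
  by exists 1 => // x; case: noS; exists x.
exists (u x0 + C) => [|x]; first exact: addr_gt0.
(* Agreement on 0 letters is vacuous, so [C] bounds the oscillation of [u]. *)
have := u_agree (n := 0) (x := x) (y := x0) (fun i => ltac:(by [])); rewrite expr0 mulr1.
by move/(le_trans (ler_norm _)); rewrite lerBlDl.
Qed.

(* Koenig's lemma: otherwise some point has a neighbourhood basis of cylinders
   on which [u] has infimum 0, against [0 < u] and continuity. *)
Lemma u_bounded_below : exists2 c, 0 < c & forall x, c <= u x.
Proof.
apply: contrapT => noc.
pose bad (w : seq A) :=
  forall m : nat, exists2 x, cylinder w x & u x < m.+1%:R^-1.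
have bad0 : bad [::].
  move=> m; apply: contrapT => nox; apply: noc; exists m.+1%:R^-1 => // x.
  by rewrite leNgt; apply/negP => ux; apply: nox; exists x.
have badS w : bad w -> exists a, bad (rcons w a).
  move=> bw; apply: contrapT => /forallNP nob.
  have /choice[f fP] : forall a, exists m,
      forall x, cylinder (rcons w a) x -> m.+1%:R^-1 <= u x.
    move=> a; have /existsNP[m mP] := nob a; exists m => x wx.
    by rewrite leNgt; apply/negP => ux; apply: mP; exists x.
  have [x wx ux] := bw (\max_a f a)%N.
  have wxP : cylinder (rcons w (val x (size w))) x.
    rewrite /cylinder /= size_rcons /block -addn1 iotaD map_cat /= add0n.
    by rewrite -/(block x 0 (size w)) wx cats1.
  suff ltu a : u x < (f a).+1%:R^-1 by have := fP _ x wxP; rewrite leNgt ltu.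
  apply: lt_le_trans ux _; rewrite lef_pV2 ?posrE ?ltr0n // ler_nat ltnS.
  exact: leq_bigmax.
have [x0 _ _] := bad0 0%N.
have /choice[ext extP] : forall w, exists a, bad w -> bad (rcons w a).
  move=> w; have [/badS[a ba]|nb] := pselect (bad w); first by exists a.
  by exists (val x0 0%N).
pose pre n := iter n (fun w => rcons w (ext w)) [::].
pose xi n := ext (pre n).
have bad_pre n : bad (pre n) by elim: n => //= n IH; exact: extP.
have preE n : pre n = [seq xi i | i <- iota 0 n].
  by elim: n => // n IH; rewrite -addn1 iotaD map_cat /= cats1 -IH addn1.
have pre_agree n x : cylinder (pre n) x -> forall i, (i < n)%N -> xi i = val x i.
  rewrite /cylinder /= preE size_map size_iota => /eq_in_map exi i iltn.
  by rewrite exi // mem_iota.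
have xiS : xi \in Sigma M.
  apply/mem_set => i; have [x /pre_agree px _] := bad_pre i.+2 0%N.
  by rewrite !px //; exact: SigmaP.
pose x : Sigma M := SigSub xiS.
have ux := u_gt0 x.
(* A point [y] of the cylinder [pre n] with [u y < m.+1%:R^-1] will give
   [u x <= u y + C * theta ^+ n < u x]. *)
have [n nP] : exists n, C * theta ^+ n < u x / 2.
  have /cvgrPdist_lt /(_ (u x / 2 / C)) : (theta ^+ n @[n --> \oo] --> (0 : R)).
    by apply: cvg_expr; rewrite gtr0_norm //; case/andP: theta_itv.
  have /[swap]/[apply] : 0 < u x / 2 / C by rewrite !divr_gt0.
  move=> [n _ /(_ n (leqnn n))] /=; rewrite sub0r normrN gtr0_norm ?exprn_gt0 //.
  by rewrite ltr_pdivlMr // mulrC => ?; exists n.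
have [m mP] : exists m, m.+1%:R^-1 < u x / 2.
  exists (Num.truncn (u x / 2)^-1); rewrite invf_plt ?posrE ?ltr0n ?divr_gt0 //.
  exact: truncnS_gt.
have [y /pre_agree xy uy] := bad_pre n m.
have := u_agree (x := x) xy; move/(le_trans (ler_norm _)) => H.
by move: (lt_trans uy mP) nP H; clear; lra.
Qed.

End Modulus.

End Potential.

(** * Dimension of the sets of syndetic occurrences *)

Section Expansion.
Variables (A : finType) (M : rel A) (R : realType) (u : Sigma M -> R).
Variables (N L : nat) (loop : A -> seq A) (c D K : R).
Hypotheses (N_gt0 : (0 < N)%N) (L_gt0 : (0 < L)%N).
Hypothesis loopP : forall a, loop_at M a (loop a).
Hypothesis size_loop : forall a, size (loop a) = L.
Hypotheses (u_gt0 : forall x, 0 < u x) (c_gt0 : 0 < c) (D_gt0 : 0 < D) (K_gt0 : 0 < K).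
Hypotheses (u_ge : forall x, c <= u x) (u_le : forall x, u x <= D).
Hypothesis distortion : forall r (x y : Sigma M), (r <= N)%N ->
  (forall i, (i < N)%N -> val x i = val y i) ->
  birkhoff_sum u r x <= birkhoff_sum u r y + K.

Local Notation ins := (insertion N_gt0 L_gt0 loopP size_loop).
Local Notation e_ := (stretch N L).
(** The cost of one insertion: [K] for the distortion on a block, [L%:R * D] for the letters of the
    loop. *)
Local Notation K1 := (K + L%:R * D).

Let K1_gt0 : 0 < K1. Proof. by rewrite addr_gt0 // mulr_gt0 // ltr0n. Qed.

Lemma insertion_prefix (x : Sigma M) i : (i < N)%N -> val (ins x) i = val x i.
Proof.
move=> iN; have := insertion_stretch N_gt0 L_gt0 loopP size_loop x i.
by rewrite /stretch divn_small // modn_small.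
Qed.

(** Each full period costs at most [K1], because [ins x] and [x] agree on their first [N] letters.
    The final incomplete block costs a further [K <= K1], hence the successor. *)
Lemma birkhoff_sum_insertion n (x : Sigma M) :
  birkhoff_sum u (e_ n) (ins x) <= birkhoff_sum u n x + (n %/ N).+1%:R * K1.
Proof.
rewrite {2}(divn_eq n N) /stretch.
have := ltnW (ltn_pmod n N_gt0); move: (n %/ N)%N (n %% N)%N => q r rN.
elim: q x => [|q IH] x.
  rewrite !mul0n !add0n mul1r; apply: le_trans (distortion (y := x) rN _) _.
    exact: insertion_prefix.
  by rewrite lerD2l lerDl mulr_ge0 ?ler0n // ltW.
rewrite !mulSn -(addnA (N + L)%N) -(addnA N (q * N)%N) birkhoff_sumD iter_shift_insertion.
rewrite [birkhoff_sum u (N + (_ + _)) x]birkhoff_sumD -natr1 mulrDl mul1r.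
have := IH (iter N (@Defs.shift A M) x).
have : birkhoff_sum u (N + L) (ins x) <= birkhoff_sum u N x + K1.
  rewrite birkhoff_sumD addrA; apply: lerD; last exact: birkhoff_sum_le.
  apply: distortion => //; exact: insertion_prefix.
set a := birkhoff_sum _ _ _; set b := birkhoff_sum _ _ _.
set a' := birkhoff_sum _ _ _; set b' := birkhoff_sum _ _ _.
by move=> *; lra.
Qed.

(** The [n %/ N] full blocks contribute at least [(n %/ N)%:R * (N%:R * c)] to the sum of [u], and a
    fraction [e] of this pays for their insertions. *)
Lemma birkhoff_sum_insertion_ratio (e : R) n (x : Sigma M) :
  K1 <= e * (N%:R * c) ->
  birkhoff_sum u (e_ n) (ins x) <= (1 + e) * birkhoff_sum u n x + K1.
Proof.
move=> K1e; apply: le_trans (birkhoff_sum_insertion n x) _.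
rewrite -natr1 !mulrDl !mul1r !addrA; do 2!rewrite lerD2r; rewrite lerD2l.
have e0 : 0 <= e.
  have Nc : 0 < N%:R * c by rewrite mulr_gt0 // ltr0n.
  by rewrite -(pmulr_lge0 _ Nc) (le_trans (ltW K1_gt0)).
apply: (@le_trans _ _ ((n %/ N)%:R * (e * (N%:R * c)))).
  by rewrite ler_wpM2l.
rewrite mulrCA ler_wpM2l //; apply: le_trans (birkhoff_sum_ge n x u_ge).
by rewrite mulrA -natrM ler_wpM2r ?(ltW c_gt0) // ler_nat leq_trunc_div.
Qed.

Lemma birkhoff_sum_le_word n (x z : Sigma M) :
  (forall i, (i < n)%N -> val x i = val z i) ->
  - birkhoff_sum u n z <= birkhoff_word (fun y => - u y) (block x 0 n).
Proof.
move=> xz; rewrite -birkhoff_sumN; apply: ub_le_sup.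
  exists 0 => _ [y _ <-]; rewrite -[leRHS](mulr0 (size (block x 0 n))%:R).
  by apply: birkhoff_sum_le => w; rewrite oppr_le0 ltW.
by exists z; [exact/cylinder_blockP | rewrite size_block].
Qed.

Lemma d_u_insertion (e : R) (x y : Sigma M) : 0 < e -> K1 <= e * (N%:R * c) ->
  d_u u x y `^ (1 + e) <= expR K1 * d_u u (ins x) (ins y).
Proof.
move=> e0 K1e; have e1 : 0 < 1 + e by rewrite addr_gt0.
rewrite {1}/d_u; case: asboolP => [_|xy].
  rewrite powR0 ?lt0r_neq0 // mulr_ge0 ?expR_ge0 // /d_u.
  by case: ifP => // _; exact: expR_ge0.
have [n [exy nxy]] := first_difference xy.
have eixy := insertion_agree N_gt0 L_gt0 loopP size_loop exy.
have nixy : val (ins x) (e_ n) <> val (ins y) (e_ n).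
  by rewrite !insertion_stretch.
have ixy : ins x <> ins y by move=> E; apply: nixy; rewrite E.
rewrite /d_u asboolF // (wedge_first_difference exy nxy).
rewrite (wedge_first_difference eixy nixy).
rewrite {1}/powR expR_eq0 expRK -expRD ler_expR mulrC -ler_pdivlMr //.
apply: ge_sup.
  by exists (birkhoff_sum (fun z => - u z) (size (block x 0 n)) x); exists x => //;
    apply/cylinder_blockP.
move=> _ [z /cylinder_blockP xz <-]; rewrite size_block birkhoff_sumN.
rewrite ler_pdivlMr //.
have := birkhoff_sum_insertion_ratio n z K1e.
have := birkhoff_sum_le_word
  (insertion_agree N_gt0 L_gt0 loopP size_loop xz).
set a := birkhoff_sum _ _ _; set b := birkhoff_sum _ _ _.
set w := birkhoff_word _ _; by move=> *; lra.
Qed.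

End Expansion.

Section DimensionF.
Variables (A : finType) (M : rel A) (R : realType) (u : Sigma M -> R).
Hypothesis M_trans : transitive_sft M.
Hypothesis u_gt0 : forall x, 0 < u x.
Hypothesis u_hoelder : hoelder_continuous u.

Lemma d_u_ge0 x y : 0 <= d_u u x y.
Proof. by rewrite /d_u; case: ifP => // _; exact: expR_ge0. Qed.

Lemma dim_u_F (W : set (seq A)) : finite_set W ->
  (forall w, W w -> sorted M w) -> dim_u u (@F A M W) = dim_u u [set: Sigma M].
Proof.
move=> /finite_seqP[ws ->] W_adm; apply/eqP; rewrite eq_le.
rewrite hausdorff_dim_subset //=.
apply: hausdorff_dim_le => [||e e0]; [exact: d_u_ge0|exact: d_u_ge0|].
have sws : all (sorted M) ws by apply/allP => w /W_adm.
have [L [loop [L0 loopP]]] := loops_of_same_length M_trans sws.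
have [theta [C [theta01 C0 u_agree]]] := hoelder_agree u_hoelder.
have [D D0 uD] := u_bounded C0 u_agree u_gt0.
have [c c0 cu] := u_bounded_below theta01 C0 u_agree u_gt0.
pose K := C / (1 - theta).
have K0 : 0 < K by rewrite divr_gt0 // subr_gt0; case/andP: theta01.
(* Only [N] depends on [e]; the loops and the constants [K], [D], [c] are fixed before it. *)
pose N := (Num.truncn ((K + L%:R * D) / (e * c))).+1.
have N0 : (0 < N)%N by [].
have KN : K + L%:R * D <= e * (N%:R * c).
  by rewrite mulrCA -ler_pdivrMr ?mulr_gt0 // ltW // truncnS_gt.
have lP a : loop_at M a (loop a) by have [] := loopP a.
have sl a : size (loop a) = L by have [] := loopP a.
exists (insertion N0 L0 lP sl), (expR (K + L%:R * D)); split.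
- exact: expR_gt0.
- move=> _ [x _ <-]; exists (2 * (N + L))%N; first by rewrite /= muln_gt0 addn_gt0.
  apply: insertion_F_k => a w /= ww; have [_ _ /allP] := loopP a; exact.
move=> x y; apply: d_u_insertion KN => //.
by move=> r z t rN zt; apply: birkhoff_distortion zt.
Qed.

End DimensionF.

(** * Dimension of the sets of bounded repetitions *)

Section DimensionF'.
Variables (A : finType) (M : rel A) (R : realType) (u : Sigma M -> R).

(* In this case [Sigma] is contained in the orbit of the periodic sequence with
   period [w]. *)
Lemma dim_u_periodic (w : seq A) : w <> [::] ->
  (forall v, sorted M v -> exists l, infix v (wpow w l)) ->
  dim_u u [set: Sigma M] = 0%E.
Proof.
case: w => // a w' _; set w := a :: w' => wP.
(* The periodic sequence with period [w] started at phase [j], as a set with at most one point. *)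
pose U j : set (Sigma M) :=
  [set x | forall i, val x i = nth a w ((i + j)%N %% size w)].
apply: (@hausdorff_dim_countable _ _ _ _ U) => [x|j x y Ux Uy|x _].
- by rewrite /d_u asboolT.
- by apply: Sigma_ext => i; rewrite Ux Uy.
apply: contrapT => nU.
have /choice[f fP] : forall j, exists i, val x i <> nth a w ((i + j)%N %% size w).
  by move=> j; apply/existsNP => xj; apply: nU; exists j.
(* A block of this length reveals that [x] differs from the periodic sequence of every phase, yet it
   occurs in some power of [w], at the phase given by the length of the prefix [s]. *)
pose n := (\max_(j < size w) f j).+1.
have [l /infixP[s [s' wE]]] := wP _ (sorted_block x 0 n).
have j_lt : (size s %% size w < size w)%N by rewrite ltn_mod.
set j := (size s %% size w)%N in j_lt.
have fjn : (f j < n)%N by rewrite ltnS (leq_bigmax (Ordinal j_lt)).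
clearbody n; apply: (fP j); rewrite /j modnDmr addnC -(@nth_wpow _ a w l).
  by rewrite wE nth_cat ltnNge leq_addr addKn nth_cat size_block fjn nth_block.
by rewrite -size_wpow wE !size_cat size_block ltn_add2l ltn_addr.
Qed.

(** As [w] is nonempty, [w] to the power [k] has length at least [k]; an occurrence of it in [x]
    would contain a window of length [k], and with it [v w]. *)
Lemma F_subset_F' (W : set (seq A)) (v : seq A -> seq A) : ~ W [::] ->
  (forall w, W w -> forall l, ~ infix (v w) (wpow w l)) ->
  @F A M (v @` W) `<=` @F' A M W.
Proof.
move=> W0 vP x [k k1 Fx]; exists k => // w Ww [n nw]; apply: (vP w Ww k).
rewrite -nw; apply: infix_trans (Fx n I (v w) _) _; first by exists w.
apply: infix_block => //; rewrite leq_add2l size_wpow leq_pmulr // lt0n size_eq0.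
by apply/eqP => w0; rewrite w0 in Ww.
Qed.

End DimensionF'.

Theorem corollary1p5 (R : realType) (A : finType) (M : rel A)
  (A_ge2 : (2 <= #|A|)%N)
  (M_row : forall a : A, exists b : A, M a b)
  (M_trans : transitive_sft M)
  (u : Sigma M -> R)
  (u_gt0 : forall xi : Sigma M, 0 < u xi)
  (u_hoelder : hoelder_continuous u)
  (W : set (seq A))
  (W_fin : finite_set W)
  (W_adm : forall w : seq A, W w -> sorted M w) :
  dim_u u (@F A M W) = dim_u u [set: Sigma M] /\
  (* the empty word is contained in every sequence, so F' is empty if it is in W *)
  (~ W [::] -> dim_u u (@F' A M W) = dim_u u [set: Sigma M]).
Proof.
split=> [|W0]; first exact: dim_u_F.
have [[w [Ww wP]]|Wnp] := pselect (exists w, W w /\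
    forall v, sorted M v -> exists l, infix v (wpow w l)).
  have S0 : dim_u u [set: Sigma M] = 0%E.
    by apply: (dim_u_periodic u (w := w) _ wP) => w0; rewrite w0 in Ww.
  (* Since [Sigma] has dimension 0, nonnegativity of the dimension gives the lower bound. *)
  apply/eqP; rewrite eq_le {2}S0 hausdorff_dim_ge0 andbT.
  exact: hausdorff_dim_subset.
have /choice[v vP] : forall w, exists v, W w ->
    sorted M v /\ forall l, ~ infix v (wpow w l).
  move=> w; have [Ww|] := pselect (W w); last by exists [::].
  apply: contrapT => /forallNP nv; apply: Wnp; exists w; split=> // v sv.
  apply: contrapT => /forallNP nl; exact: (nv v).
apply/eqP; rewrite eq_le hausdorff_dim_subset //=.
(* The first assertion, for the finite set of the words [v w], provides a subset of full
   dimension. *)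
rewrite -(dim_u_F M_trans u_gt0 u_hoelder (W := v @` W)).
- apply: hausdorff_dim_subset; apply: F_subset_F' => // w /vP[_]; exact.
- exact: finite_image.
by move=> _ [w /vP[sv _] <-].
Qed.
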